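(* Let $(a_n)_{n\ge 0}$ be the Somos-5 sequence, defined by $a_0=a_1=a_2=a_3=a_4=1$ and $a_n=\dfrac{a_{n-1}a_{n-4}+a_{n-2}a_{n-3}}{a_{n-5}}$ for $n\ge 5$. Then: (a) $\gcd(a_n,a_{n-1})=\gcd(a_n,a_{n-2})=1$ for every $n\ge 2$; (b) $\gcd(a_n,a_{n-1})=\gcd(a_n,a_{n-2})=\gcd(a_n,a_{n-3})=\gcd(a_n,a_{n-4})=1$ for every $n\ge 4$.
   Context: The Somos-5 sequence is a priori a sequence of positive rational numbers given by the stated recursion; its first terms, starting with $a_0$, are $1,1,1,1,1,2,3,5,11,37,83,274,\dots$. All of its terms are in fact natural numbers (positive integers), and $\gcd$ denotes the usual greatest common divisor of natural numbers. *)

(* Defs.v *)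
From mathcomp Require Import all_boot all_order all_algebra.

Set Implicit Arguments.
Unset Strict Implicit.
Unset Printing Implicit Defensive.

Import Order.TTheory GRing.Theory Num.Theory.

Local Open Scope ring_scope.

(* With n = m + 5, the pattern variables n1, .., n4 are n - 1, .., n - 4.    *)
(* All terms are positive, so the value x / 0 = 0 is never used.             *)
Fixpoint somos5 (n : nat) : rat :=
  match n with
  | ((((m.+1 as n4).+1 as n3).+1 as n2).+1 as n1).+1 =>
      (somos5 n1 * somos5 n4 + somos5 n2 * somos5 n3) / somos5 m
  | _ => 1
  end.

Lemma somos5_init (n : nat) : (n < 5)%N -> somos5 n = 1.
Proof. by case: n => [|[|[|[|[|n]]]]]. Qed.

Lemma somos5_rec (n : nat) : (5 <= n)%N ->
  somos5 n = (somos5 (n - 1) * somos5 (n - 4) + somos5 (n - 2) * somos5 (n - 3))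
             / somos5 (n - 5).
Proof. by case: n => [|[|[|[|[|n]]]]] // _; rewrite !subSS !subn0. Qed.

(* Main.v *)
Require Import Defs.
From mathcomp Require Import all_boot all_order all_algebra.
From mathcomp Require Import ring.

(** Integrality and coprimality are proved together, because each feeds the
    other.

    Coprimality.  Let [x0, .., x4] be consecutive pairwise coprime terms and
    [x5 * x0 = x4 * x1 + x3 * x2].  Each of [x1, .., x4] divides one summand on
    the right and is coprime to the other, hence it is coprime to [x5 * x0] and
    to [x5].  So pairwise coprimality passes from one window of five consecutive
    terms to the next ([coprime_window_next]); it holds for the window of ones.

    Integrality.  The division that produces the term of index [k + 10] is by
    the term of index [k + 5].  Number the terms from [k] on as [x0, .., x9].
    Modulo [x5] the terms [x1, .., x4] are invertible, and the recurrence gives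
    [x6 = x3 x4 / x1], [x7 = x3 x6 / x2], [x8 = x4 x7 / x3] and
    [x9 = x6 x7 / x4].  Therefore
      [x9 x6 + x8 x7 = x6 x7 (x3 / x1 + x4 / x2)
                     = x6 x7 (x4 x1 + x3 x2) / (x1 x2)],
    and [x4 x1 + x3 x2 = x5 x0] vanishes modulo [x5].  This is [somos_dvdn].

    The sequence of natural numbers is defined by Euclidean division; the two
    facts above show that every division is exact, so its terms are those of the
    rational sequence. *)

Set Implicit Arguments.
Unset Strict Implicit.
Unset Printing Implicit Defensive.

Import Order.TTheory GRing.Theory Num.Theory.

Local Open Scope nat_scope.

Definition somos_rel (a : nat -> nat) (k : nat) : Prop :=
  a (5 + k) * a k = a (4 + k) * a (1 + k) + a (3 + k) * a (2 + k).

Definition coprime_window (a : nat -> nat) (k : nat) : bool :=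
  pairwise coprime [:: a k; a (1 + k); a (2 + k); a (3 + k); a (4 + k)].

(** Modulo [x] the sum is [z * t], a unit; hence so is the factor [p]. *)
Lemma coprime_sum_prod (p q x y z t : nat) :
  p * q = x * y + z * t -> coprime z x -> coprime t x -> coprime x p.
Proof.
move=> def_pq co_zx co_tx.
have: coprime x (p * q).
  by rewrite def_pq mulnC /coprime gcdnMDl -/(coprime _ _) coprimeMr
             ![coprime x _]coprime_sym co_zx.
by rewrite coprimeMr => /andP[].
Qed.

Lemma coprime_window_next (a : nat -> nat) (k : nat) :
  somos_rel a k -> coprime_window a k -> coprime_window a k.+1.
Proof.
rewrite /somos_rel /coprime_window /= !addnS => rel.
rewrite !andbT => /and4P[_ /and3P[c12 c13 c14] /andP[c23 c24] c34].
rewrite c12 c13 c14 c23 c24 c34 /=.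
set p := a (5 + k) in rel *.
have swap x y z t : p * a k = x * y + z * t -> p * a k = y * x + z * t.
  by rewrite (mulnC y).
have flip x y z t : p * a k = x * y + z * t -> p * a k = z * t + x * y.
  by rewrite addnC.
(* Each of the four factors on the right is brought to the leftmost place. *)
apply/and4P; split.
- by apply: (coprime_sum_prod (swap _ _ _ _ rel)); rewrite coprime_sym.
- apply: (coprime_sum_prod (swap _ _ _ _ (flip _ _ _ _ rel))) => //.
  by rewrite coprime_sym.
- by apply: (coprime_sum_prod (flip _ _ _ _ rel)) => //; rewrite coprime_sym.
- exact: (coprime_sum_prod rel).
Qed.

(** The hypotheses are five consecutive instances of the recurrence; the
    quotients by [x1, .., x4] modulo [x5] are replaced by multiplying the goal
    by these numbers, which are coprime to [x5]. *)
Lemma somos_dvdn (x0 x1 x2 x3 x4 x5 x6 x7 x8 x9 : nat) :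
    x5 * x0 = x4 * x1 + x3 * x2 -> x6 * x1 = x5 * x2 + x4 * x3 ->
    x7 * x2 = x6 * x3 + x5 * x4 -> x8 * x3 = x7 * x4 + x6 * x5 ->
    x9 * x4 = x8 * x5 + x7 * x6 ->
    coprime x5 x1 -> coprime x5 x2 -> coprime x5 x3 -> coprime x5 x4 ->
  x5 %| x9 * x6 + x8 * x7.
Proof.
move=> r0 r1 r2 r3 r4 c1 c2 c3 c4.
(* Eliminate x9 and x8, then x7, then x6; at each stage the summand with the
   factor x5 is dropped. *)
have elim98: x3 * x4 * (x9 * x6 + x8 * x7)
    = (x3 * x6 * x8 + x4 * x6 * x7) * x5 + x7 * (x3 * x6 ^ 2 + x4 ^ 2 * x7).
  have ->: x3 * x4 * (x9 * x6 + x8 * x7)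
    = x3 * x6 * (x9 * x4) + x4 * x7 * (x8 * x3) by ring.
  by rewrite r3 r4; ring.
have elim7: x2 * (x3 * x6 ^ 2 + x4 ^ 2 * x7)
    = x4 ^ 3 * x5 + x3 * x6 * (x2 * x6 + x4 ^ 2).
  have ->: x2 * (x3 * x6 ^ 2 + x4 ^ 2 * x7)
    = x2 * x3 * x6 ^ 2 + x4 ^ 2 * (x7 * x2) by ring.
  by rewrite r2; ring.
have elim6: x1 * (x2 * x6 + x4 ^ 2) = (x2 ^ 2 + x4 * x0) * x5.
  have ->: x1 * (x2 * x6 + x4 ^ 2) = x2 * (x6 * x1) + x1 * x4 ^ 2 by ring.
  have ->: (x2 ^ 2 + x4 * x0) * x5 = x2 ^ 2 * x5 + x4 * (x5 * x0) by ring.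
  by rewrite r1 r0; ring.
have c34 : coprime x5 (x3 * x4) by rewrite coprimeMr c3.
rewrite -(Gauss_dvdr _ c34) elim98 dvdn_addr ?dvdn_mull //.
rewrite -(Gauss_dvdr _ c2) elim7 dvdn_addr ?dvdn_mull //.
by rewrite -(Gauss_dvdr _ c1) elim6 dvdn_mull.
Qed.

Fixpoint somos5n (n : nat) : nat :=
  match n with
  | ((((m.+1 as n4).+1 as n3).+1 as n2).+1 as n1).+1 =>
      (somos5n n1 * somos5n n4 + somos5n n2 * somos5n n3) %/ somos5n m
  | _ => 1
  end.

Lemma somos5n_rel_dvdn (k : nat) :
  somos5n k %| somos5n (4 + k) * somos5n (1 + k)
               + somos5n (3 + k) * somos5n (2 + k) ->
  somos_rel somos5n k.
Proof. exact: divnK. Qed.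

(** Coprimality is derived from an initial segment of the recurrence only, so
    that it is available inside the induction that establishes the recurrence. *)
Lemma somos5n_coprime_window_lt (n : nat) :
  (forall k, k < n -> somos_rel somos5n k) -> coprime_window somos5n n.
Proof.
elim: n => [|n IHn] rel_n; first by [].
by apply: coprime_window_next; [apply: rel_n | apply: IHn => k /leqW/rel_n].
Qed.

Lemma somos5n_rel (n : nat) : somos_rel somos5n n.
Proof.
elim/ltn_ind: n => n IHn; apply: somos5n_rel_dvdn.
(* The first five divisions are by 1. *)
have [lt_n5 | ge_n5] := ltnP n 5.
  by case: n lt_n5 {IHn} => [|[|[|[|[|n]]]]] // _; exact: dvd1n.
have {ge_n5} [m def_n] : exists m, n = 5 + m by exists (n - 5); rewrite subnKC.
move: IHn; rewrite {n}def_n => IHn.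
have rel i : i < 5 -> somos_rel somos5n (i + m).
  by move=> lt_i5; apply: IHn; rewrite ltn_add2r.
have: coprime_window somos5n m.+1.
  apply: somos5n_coprime_window_lt => k lt_km; apply: IHn.
  by rewrite (leq_trans lt_km) // addSn ltnS leq_addl.
rewrite /coprime_window !addnS.
move=> /and5P[/and5P[_ _ _ c15 _] /and4P[_ _ c25 _] /and3P[_ c35 _] /andP[c45 _] _].
by apply: (somos_dvdn (rel 0 _) (rel 1 _) (rel 2 _) (rel 3 _) (rel 4 _));
  rewrite // coprime_sym.
Qed.

Lemma somos5n_coprime_window (n : nat) : coprime_window somos5n n.
Proof. by apply: somos5n_coprime_window_lt => k _; apply: somos5n_rel. Qed.

Lemma somos5n_gt0 (n : nat) : 0 < somos5n n.
Proof.
elim/ltn_ind: n => -[|[|[|[|[|n]]]]] // IHn.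
have: 0 < somos5n (5 + n) * somos5n n.
  have IH i : i < 5 -> 0 < somos5n (i + n).
    by move=> lt_i5; apply: IHn; rewrite -[n.+1.+4]/(5 + n) ltn_add2r.
  by rewrite somos5n_rel addn_gt0 muln_gt0 !IH.
by rewrite muln_gt0 => /andP[].
Qed.

Local Open Scope ring_scope.

Lemma somos5nE (n : nat) : somos5 n = (somos5n n)%:R.
Proof.
elim/ltn_ind: n => -[|[|[|[|[|n]]]]] // IHn.
have nz : (somos5n n)%:R != 0 :> rat by rewrite pnatr_eq0 -lt0n somos5n_gt0.
have recQ : somos5 (5 + n) = (somos5 (4 + n) * somos5 (1 + n)
   + somos5 (3 + n) * somos5 (2 + n)) / somos5 n by [].
have IH i : (i < 5)%N -> somos5 (i + n) = (somos5n (i + n))%:R.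
  by move=> lt_i5; apply: IHn; rewrite -[n.+1.+4]/(5 + n)%N ltn_add2r.
rewrite -[n.+1.+4]/(5 + n)%N recQ !IH // (IH 0) //.
by apply: (canLR (mulfK nz)); rewrite -!natrM -natrD somos5n_rel.
Qed.

Theorem theorem1 :
  exists a : nat -> nat,
    [/\ forall n : nat, (0 < a n)%N /\ somos5 n = (a n)%:R,
        forall n : nat, (2 <= n)%N ->
          gcdn (a n) (a (n - 1)%N) = 1%N /\ gcdn (a n) (a (n - 2)%N) = 1%N
      & forall n : nat, (4 <= n)%N ->
          [/\ gcdn (a n) (a (n - 1)%N) = 1%N,
              gcdn (a n) (a (n - 2)%N) = 1%N,
              gcdn (a n) (a (n - 3)%N) = 1%N
            & gcdn (a n) (a (n - 4)%N) = 1%N]].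
Proof.
exists somos5n; split=> [n | [|[|n]] // _ | [|[|[|[|n]]]] // _].
- by split; [apply: somos5n_gt0 | apply: somos5nE].
- have := somos5n_coprime_window n.
  move=> /andP[/and3P[_ c02 _] /andP[/and3P[c12 _ _] _]].
  by rewrite !subSS !subn0; split; rewrite gcdnC; apply/eqP.
- have := somos5n_coprime_window n.
  move=> /and5P[/and5P[_ _ _ c04 _] /and4P[_ _ c14 _] /and3P[_ c24 _] /andP[c34 _] _].
  by rewrite !subSS !subn0; split; rewrite gcdnC; apply/eqP.
Qed.
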